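(* Let $A$ be a left brace, let $I$ be an ideal in $A$, and let $(X,r)$ be a set-theoretic solution of the quantum Yang-Baxter equation such that $X\subseteq A$ and $r$ is a restriction of the Yang-Baxter map associated to $A$. Let $(X_I,\tilde r)$ be the $I$-retraction of $(X,r)$. Let $D=\{d_{[x]_I,[y]_I}\}_{[x]_I,[y]_I\in X_I}$ for some nonzero $d_{[x]_I,[y]_I}\in\mathbb{C}$, and define $D'=\{d'_{x,y}\}_{x,y\in X}$ by $d'_{x,y}=d_{[x]_I,[y]_I}$ for all $x,y\in X$. If $(X_I,\tilde r^{D})$ is a braided vector space of set-theoretic type, then $(X,r^{D'})$ is a braided vector space of set-theoretic type.
   Context: A set-theoretic solution of the quantum Yang-Baxter equation (QYBE) is a pair $(X,r)$ with $X$ a non-empty set and $r:X\times X\to X\times X$ a bijection, written $r(x,y)=({}^xy,x^y)$, satisfying $r_1r_2r_1=r_2r_1r_2$ on $X^3$, where $r_1=r\times \mathrm{id}_X$, $r_2=\mathrm{id}_X\times r$. A left brace is an abelian group $(A,+)$ with a multiplication $\cdot$ such that $a\cdot(b+c)=a\cdot b+a\cdot c$ and the operation $a\circ b=a\cdot b+a+b$ makes $A$ a group. The Yang-Baxter map associated to $A$ is $r':A\times A\to A\times A$, $r'(x,y)=(x\cdot y+y,\ z\cdot x+x)$, where $z$ is the unique element with $z\cdot(x\cdot y+y)+z+x\cdot y+y=0$; $r$ is a restriction of $r'$ if $r(x,y)=r'(x,y)$ for all $x,y\in X$. An ideal of $A$ is an additive subgroup $I$ with $z\cdot x,\ x\cdot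 z\in I$ for all $x\in I$, $z\in A$. The $I$-retraction $(X_I,\tilde r)$: for $x\in X$ put $[x]_I=\{x+i:i\in I\}$; $X_I$ is the set of these cosets (with $[x]_I$ and $[y]_I$ identified iff $x-y\in I$), and $\tilde r([x]_I,[y]_I)=([{}^xy]_I,[x^y]_I)$. It is a set-theoretic solution of the QYBE. For a set-theoretic solution $(X,r)$ and a family $D=\{d_{x,y}\}_{x,y\in X}$ of nonzero complex numbers, let $V$ be the complex vector space with basis $X$; $(X,r^D)$ is a braided vector space of set-theoretic type if the linear map $r^D:V\otimes V\to V\otimes V$, $r^D(x\otimes y)=d_{x,y}\,{}^xy\otimes x^y$, satisfies the QYBE $(c\otimes I_V)(I_V\otimes c)(c\otimes I_V)=(I_V\otimes c)(c\otimes I_V)(I_V\otimes c)$ with $c=r^D$. *)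

(* Defs.v *)
From HB Require Import structures.
From mathcomp Require Import all_boot all_order all_algebra.
From mathcomp Require Import finmap.
From mathcomp Require Import boolp classical_sets reals.
From mathcomp Require Import complex.
From mathcomp.multinomials Require Import monalg.

Set Implicit Arguments.
Unset Strict Implicit.
Unset Printing Implicit Defensive.

Import GRing.Theory.

Local Open Scope classical_set_scope.
Local Open Scope ring_scope.

(* The complex numbers are R[i] with R : realType, and the vector space with  *)
(* basis X is {malg R[i][X]}, the finitely supported functions X -> R[i],     *)
(* whose basis vector at x is << x >>.                                        *)

Section SetTheoreticSolution.
Variables (X : Type) (r : X * X -> X * X).

Definition r12 (t : X * X * X) : X * X * X := (r t.1, t.2).

Definition r23 (t : X * X * X) : X * X * X :=
  let p := r (t.1.2, t.2) in (t.1.1, p.1, p.2).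

Definition set_solution : Prop :=
  [/\ inhabited X, bijective r & r12 \o r23 \o r12 =1 r23 \o r12 \o r23].

End SetTheoreticSolution.

Definition is_group (G : Type) (op : G -> G -> G) : Prop :=
  associative op /\
  exists e, [/\ left_id e op, right_id e op &
                forall a, exists b, op a b = e /\ op b a = e].

HB.mixin Record Zmodule_isLeftBrace A of GRing.Zmodule A := {
  bmul : A -> A -> A;
  bmulDr : right_distributive bmul +%R;
  bcirc_group : is_group (fun a b => bmul a b + a + b)
}.

#[short(type="leftBraceType")]
HB.structure Definition LeftBrace :=
  { A of GRing.Zmodule A & Zmodule_isLeftBrace A }.

Section Brace.
Variable A : leftBraceType.
Implicit Types (a b x y z : A) (I X : set A).

Definition bcirc a b : A := bmul a b + a + b.

Definition ideal I : Prop :=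
  [/\ I 0, forall x y, I x -> I y -> I (x - y) &
      forall x z, I x -> I (bmul z x) /\ I (bmul x z)].

Lemma bmul0r a : bmul a 0 = 0.
Proof. by apply: (addrI (bmul a 0)); rewrite -bmulDr !addr0. Qed.

Lemma bcircA : associative bcirc.
Proof. by have [] := @bcirc_group A. Qed.

Lemma bcirc_id0 : [/\ left_id 0 bcirc, right_id 0 bcirc &
  forall a, exists b, bcirc a b = 0 /\ bcirc b a = 0].
Proof.
have [_ [e [e1 e2 eV]]] := @bcirc_group A.
suff e0 : e = 0 by rewrite e0 in e1 e2 eV.
by rewrite -[RHS]e1 bmul0r add0r addr0.
Qed.

Lemma bcirc_inv_unique u : exists! z, bmul z u + z + u = 0.
Proof.
have [id0 idr inv] := bcirc_id0.
have [z [uz zu]] := inv u; exists z; split=> // z' z'u.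
by rewrite -[LHS]id0 -z'u -bcircA uz idr.
Qed.

(* The unique z with z . u + z + u = 0; see bcirc_inv_unique. *)
Definition bcirc_inv u : A := xget 0 [set z | bmul z u + z + u = 0].

Lemma bcirc_invP u : bmul (bcirc_inv u) u + bcirc_inv u + u = 0.
Proof.
have [z [zu _]] := bcirc_inv_unique u.
exact: (@xgetI A 0 [set z | bmul z u + z + u = 0] z zu).
Qed.

Definition yb_map (p : A * A) : A * A :=
  let u := bmul p.1 p.2 + p.2 in (u, bmul (bcirc_inv u) p.1 + p.1).

Definition yb_restriction X (r : X * X -> X * X) : Prop :=
  forall x y : X,
    (val (r (x, y)).1, val (r (x, y)).2) = yb_map (val x, val y).

Definition coset I x : set A := [set x + i | i in I].

Definition retract_carrier X I : set (set A) := coset I @` X.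

Section Retraction.
Variables (X I : set A).

Definition retract_class (x : X) : retract_carrier X I :=
  SigSub (mem_set (imageP (coset I) (set_mem (valP x)))).

Lemma retract_class_surj (c : retract_carrier X I) :
  exists x : X, retract_class x = c.
Proof.
case: c => c cP; have [x Xx xc] := set_mem cP.
by exists (SigSub (mem_set Xx)); apply/val_inj.
Qed.

Definition retract_repr (c : retract_carrier X I) : X :=
  sval (cid (retract_class_surj c)).

Lemma retract_reprK : cancel retract_repr retract_class.
Proof. by move=> c; rewrite /retract_repr; case: cid. Qed.

(* Computed on chosen representatives; by retractionE below, the result does  *)
(* not depend on them when I is an ideal and r restricts yb_map.              *)
Definition retraction (r : X * X -> X * X)
    (p : retract_carrier X I * retract_carrier X I) :
    retract_carrier X I * retract_carrier X I :=
  let q := r (retract_repr p.1, retract_repr p.2) in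
  (retract_class q.1, retract_class q.2).

End Retraction.
End Brace.

Arguments retraction {A X} I r p.

Section WellDefined.
Variable A : leftBraceType.
Implicit Types (a b x y z : A) (I X : set A).

Let lam a b : A := bmul a b + b.

Let lamD a b c : lam a (b + c) = lam a b + lam a c.
Proof. by rewrite /lam bmulDr addrACA. Qed.

Let bcircE a b : bcirc a b = a + lam a b.
Proof. by rewrite /bcirc /lam addrA [a + _]addrC. Qed.

Let lamM a b c : lam (bcirc a b) c = lam a (lam b c).
Proof.
have := bcircA a b c; rewrite ![bcirc a _]bcircE [bcirc _ c]bcircE.
by rewrite !bcircE lamD addrA => /addrI/esym; rewrite -bcircE.
Qed.

Lemma cosetP I x y : ideal I -> (coset I x = coset I y <-> I (x - y)).
Proof.
case=> I0 IB _.
have IN a : I a -> I (- a) by move=> Ia; rewrite -sub0r; apply: IB.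
have ID a b : I a -> I b -> I (a + b).
  by move=> Ia Ib; rewrite -[b]opprK; apply: IB => //; apply: IN.
split=> [xy|Ixy].
  have : coset I y x by rewrite -xy; exists 0; rewrite ?addr0.
  by case=> i Ii <-; rewrite addrC addKr.
apply/seteqP; split=> _ [i Ii <-].
  by exists (x - y + i); [exact: ID | rewrite addrA subrKC].
exists (i - (x - y)); first exact: IB.
by rewrite opprB addrCA subrKC addrC.
Qed.

Lemma yb_map_coset I x x' y y' : ideal I -> I (x' - x) -> I (y' - y) ->
  I ((yb_map (x', y')).1 - (yb_map (x, y)).1) /\
  I ((yb_map (x', y')).2 - (yb_map (x, y)).2).
Proof.
move=> idI; have [I0 IB IM] := idI.
have IN a : I a -> I (- a) by move=> Ia; rewrite -sub0r; apply: IB.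
have ID a b : I a -> I b -> I (a + b).
  by move=> Ia Ib; rewrite -[b]opprK; apply: IB => //; apply: IN.
have Ilam a i : I i -> I (lam a i).
  by move=> Ii; apply: ID => //; have [] := IM _ a Ii.
have [id0 idr inv] := @bcirc_id0 A.
have lam0 a : lam 0 a = a by have := id0 a; rewrite bcircE add0r.
(* a and a + i act alike modulo I, since a + i = a o j with j in I *)
have lamI a a' b b' : I (a' - a) -> I (b' - b) -> I (lam a' b' - lam a b).
  move=> Ia Ib; have [c [ac ca]] := inv a.
  have -> : a' = bcirc a (lam c (a' - a)).
    by rewrite bcircE -lamM ac lam0 subrKC.
  set j := lam c _; have Ij : I j by apply: Ilam.
  have -> : b' = b + (b' - b) by rewrite subrKC.
  have Ijb : I (lam a (lam j (b' - b))) by apply: (Ilam); apply: Ilam.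
  rewrite lamM (lamD j) (lamD a) addrAC; apply: ID => //.
  rewrite (lamD a (bmul j b)) addrK.
  by apply: Ilam; have [] := IM _ b Ij.
have invP (u : A) : bcirc (bcirc_inv u) u = 0 by apply: bcirc_invP.
have invI u u' : I (u' - u) -> I (bcirc_inv u' - bcirc_inv u).
  move=> Iu; have uz : bcirc u (bcirc_inv u) = 0.
    have [c [uc cu]] := inv u.
    suff -> : bcirc_inv u = c by [].
    by rewrite -[LHS]idr -uc bcircA invP id0.
  have -> : bcirc_inv u' = bcirc (bcirc_inv u') (bcirc u (bcirc_inv u)).
    by rewrite uz idr.
  rewrite -{2}[bcirc_inv u]id0 -(invP u') -bcircA.
  rewrite !(bcircE (bcirc_inv u')) opprD addrACA subrr add0r.
  apply: (lamI); first by rewrite subrr.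
  rewrite !bcircE opprD addrACA; apply: ID.
    by rewrite -opprB; apply: IN.
  by apply: lamI; [rewrite -opprB; apply: IN | rewrite subrr].
move=> Ix Iy; have Iu := lamI _ _ _ _ Ix Iy.
by split=> //=; apply: lamI => //; apply: invI.
Qed.

Lemma retractionE (X I : set A) (r : X * X -> X * X) (x y : X) :
  ideal I -> yb_restriction r ->
  retraction I r (retract_class I x, retract_class I y) =
    (retract_class I (r (x, y)).1, retract_class I (r (x, y)).2).
Proof.
move=> idI rX; rewrite /retraction /=.
set x' := retract_repr _; set y' := retract_repr _.
have sameE (u v : X) : retract_class I u = retract_class I v <->
    I (val u - val v).
  rewrite -(cosetP _ _ idI); split=> [/(congr1 val)//|uv].
  exact: val_inj.
have Ix : I (val x' - val x) by apply/sameE; rewrite retract_reprK.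
have Iy : I (val y' - val y) by apply/sameE; rewrite retract_reprK.
have [] := yb_map_coset idI Ix Iy; rewrite -!rX /= => I1 I2.
by congr pair; apply/sameE.
Qed.

End WellDefined.

Section FreeVectorSpace.
Variable K : comNzRingType.

Local Notation free X := {malg K[X%type]}.

Definition linext (X : choiceType) (U : lmodType K) (f : X -> U)
    (v : free X) : U :=
  \sum_(x <- msupp v) v@_x *: f x.

Lemma linextEw (X : choiceType) (U : lmodType K) (f : X -> U)
    (v : free X) (S : {fset X}) :
  (msupp v `<=` S)%fset -> linext f v = \sum_(x <- S) v@_x *: f x.
Proof.
move=> vS; apply: (big_fset_incl _ vS) => x _.
by move/mcoeff_outdom ->; rewrite scale0r.
Qed.

Lemma linext_is_linear (X : choiceType) (U : lmodType K) (f : X -> U) :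
  linear (linext f).
Proof.
move=> a v w; pose S := (msupp v `|` msupp w)%fset.
have vS : (msupp v `<=` S)%fset by exact: fsubsetUl.
have wS : (msupp w `<=` S)%fset by exact: fsubsetUr.
have avwS : (msupp (a *: v + w) `<=` S)%fset.
  apply: fsubset_trans (msuppD_le _ _) _.
  by rewrite fsubUset wS (fsubset_trans (msuppZ_le _ _)).
rewrite (linextEw _ avwS) (linextEw _ vS) (linextEw _ wS) scaler_sumr.
rewrite -big_split /=; apply: eq_bigr => x _.
by rewrite mcoeffD mcoeffZ scalerDl scalerA.
Qed.

HB.instance Definition _ (X : choiceType) (U : lmodType K) (f : X -> U) :=
  GRing.isLinear.Build K (free X) U _ (linext f) (linext_is_linear f).

Lemma linextU (X : choiceType) (U : lmodType K) (f : X -> U) (x : X) :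
  linext f << x >> = f x.
Proof.
by rewrite (linextEw f msuppU_le) big_seq_fset1 mcoeffUU scale1r.
Qed.

(* The tensor product of the spaces with bases X and Y is the space with      *)
(* basis X * Y, << (x, y) >> being the tensor of << x >> and << y >>.         *)
Definition tens (X Y : choiceType) (v : free X) (w : free Y) :
    free (X * Y) :=
  linext (fun x => linext (fun y => << (x, y) >>) w) v.

Definition tensmap (X Y X' Y' : choiceType)
    (f : {linear free X -> free X'})
    (g : {linear free Y -> free Y'}) :
    {linear free (X * Y) -> free (X' * Y')} :=
  linext (fun p => tens (f << p.1 >>) (g << p.2 >>)).

Definition tassoc (X Y Z : choiceType) :
    {linear free (X * Y * Z) -> free (X * (Y * Z))} :=
  linext (fun p => << (p.1.1, (p.1.2, p.2)) >>).

Definition tassocV (X Y Z : choiceType) :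
    {linear free (X * (Y * Z)) -> free (X * Y * Z)} :=
  linext (fun p => << (p.1, p.2.1, p.2.2) >>).

Definition qybe (X : choiceType)
    (c : {linear free (X * X) -> free (X * X)}) : Prop :=
  let idV : {linear free X -> free X} := idfun in
  let c12 : free (X * X * X) -> free (X * X * X) := tensmap c idV in
  let c23 : free (X * X * X) -> free (X * X * X) :=
    @tassocV X X X \o tensmap idV c \o @tassoc X X X in
  c12 \o c23 \o c12 =1 c23 \o c12 \o c23.

Definition twist (X : choiceType) (r : X * X -> X * X) (D : X -> X -> K) :
    {linear free (X * X) -> free (X * X)} :=
  linext (fun p => D p.1 p.2 *: << r p >>).

(* To be used with r a set-theoretic solution and all D x y nonzero.          *)
Definition braided_set_type (X : choiceType) (r : X * X -> X * X)
    (D : X -> X -> K) : Prop :=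
  qybe (twist r D).

End FreeVectorSpace.

(* Main.v *)
Require Import Defs.
From HB Require Import structures.
From mathcomp Require Import all_boot all_order all_algebra.
From mathcomp Require Import boolp classical_sets reals.
From mathcomp Require Import complex.
From mathcomp.multinomials Require Import monalg.

Set Implicit Arguments.
Unset Strict Implicit.
Unset Printing Implicit Defensive.

Import GRing.Theory.
Local Open Scope ring_scope.

(** The operator [twist r D] permutes the basis of tensors up to scalars, so
    both sides of the braid equation send a basis vector [<< t >>] of the triple
    tensor power to a scalar times a basis vector: the set-theoretic braid
    equation compares the basis vectors, and an identity between products of
    three values of [D] compares the scalars ([braided_set_typeP]).

    The projection of X onto its set of cosets intertwines [r] with its
    retraction ([retractionE]), because I is an ideal.  Hence the scalars produced by the pulled-back family at a
    triple of X are those produced by [d] at the triple of its cosets.  The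
    latter agree by hypothesis, because a nonzero multiple of a basis vector
    determines its scalar ([malg_scaleU_inj]), and the basis vectors over X
    agree because [r] is a solution.  This pullback works along any map
    intertwining two maps on pairs ([braided_set_type_pullback]). *)

Section BasisAction.
Variable K : comNzRingType.

Local Notation free X := {malg K[X%type]}.

Lemma malg_linear_ext (X : choiceType) (U : lmodType K)
    (f g : {linear free X -> U}) :
  (forall x, f << x >> = g << x >>) -> f =1 g.
Proof.
move=> fg v; rewrite (monalgE v) !linear_sum; apply: eq_bigr => x _.
have -> : << v@_x *g x >> = v@_x *: << x >> :> free X.
  by apply/malgP => y; rewrite mcoeffZ !mcoeffU mulrnAr mulr1.
by rewrite !linearZ fg.
Qed.

Section Twist.
Variables (X : choiceType) (r : X * X -> X * X) (D : X -> X -> K).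
Implicit Type t : X * X * X.
Local Notation X3 := (X * X * X)%type.

(** The scalar that [<< t >>] picks up when the twist acts on positions 12, 23
    and 12 in this order; [weight212] is its analogue for 23, 12, 23. *)
Definition weight121 t : K :=
  let t1 := r12 r t in let t2 := r23 r t1 in
  D t.1.1 t.1.2 * D t1.1.2 t1.2 * D t2.1.1 t2.1.2.

Definition weight212 t : K :=
  let t1 := r23 r t in let t2 := r12 r t1 in
  D t.1.2 t.2 * D t1.1.1 t1.1.2 * D t2.1.2 t2.2.

Lemma twist12U t :
  tensmap (twist r D) idfun << t >> = D t.1.1 t.1.2 *: << r12 r t >>.
Proof.
case: t => [[x y] z].
by rewrite /tensmap /twist /= !linextU /tens linearZ /= !linextU.
Qed.

Lemma twist23U t :
  tassocV _ _ _ _ (tensmap idfun (twist r D) (tassoc _ _ _ _ << t >>))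
  = D t.1.2 t.2 *: << r23 r t >>.
Proof.
case: t => [[x y] z].
rewrite /tassocV /tensmap /tassoc /twist /= !linextU /tens /= !linextU.
by rewrite linearZ /= linextU linearZ /= linextU.
Qed.

(** By linearity the braid equation can be tested on basis vectors, where it
    becomes an equality between multiples of basis vectors. *)
Lemma braided_set_typeP :
  braided_set_type r D <->
  forall t, weight121 t *: << (r12 r \o r23 r \o r12 r) t >> =
            weight212 t *: << (r23 r \o r12 r \o r23 r) t >> :> free X3.
Proof.
pose c12 : {linear free X3 -> free X3} := tensmap (twist r D) idfun.
pose c23 : {linear free X3 -> free X3} :=
  tassocV K X X X \o tensmap idfun (twist r D) \o tassoc K X X X.
have c12U t : c12 << t >> = D t.1.1 t.1.2 *: << r12 r t >> by exact: twist12U.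
have c23U t : c23 << t >> = D t.1.2 t.2 *: << r23 r t >> by exact: twist23U.
have c12Z a v : c12 (a *: v) = a *: c12 v by exact: linearZ.
have c23Z a v : c23 (a *: v) = a *: c23 v by exact: linearZ.
have E121 t : c12 (c23 (c12 << t >>)) =
    weight121 t *: << (r12 r \o r23 r \o r12 r) t >>.
  by rewrite c12U c23Z c23U !c12Z c12U !scalerA.
have E212 t : c23 (c12 (c23 << t >>)) =
    weight212 t *: << (r23 r \o r12 r \o r23 r) t >>.
  by rewrite c23U c12Z c12U !c23Z c23U !scalerA.
split=> [br t | wE]; first by rewrite -E121 -E212; exact: br.
apply: (@malg_linear_ext _ _ (c12 \o c23 \o c12) (c23 \o c12 \o c23)) => t.
exact: etrans (E121 t) (etrans (wE t) (esym (E212 t))).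
Qed.

End Twist.
End BasisAction.

Lemma malg_scaleU_inj (K : nzRingType) (T : choiceType) (a b : K) (s t : T) :
  a != 0 -> a *: << s >> = b *: << t >> :> {malg K[T]} -> a = b.
Proof.
move=> a0 /(congr1 (mcoeff s)); rewrite !mcoeffZ !mcoeffU eqxx mulr1.
by case: eqP => _; rewrite ?mulr1 // mulr0 => /eqP; rewrite (negPf a0).
Qed.

(** A triple over X and its image under [q] have the same weights, since [q]
    intertwines the actions of [r] and [s] on triples.  Nonvanishing of [D] lets the
    identity of weights be read off from the braid equation over Y. *)
Lemma braided_set_type_pullback (K : idomainType) (X Y : choiceType)
    (r : X * X -> X * X) (s : Y * Y -> Y * Y) (q : X -> Y) (D : Y -> Y -> K) :
  (forall x y, s (q x, q y) = (q (r (x, y)).1, q (r (x, y)).2)) ->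
  (forall y z, D y z != 0) ->
  r12 r \o r23 r \o r12 r =1 r23 r \o r12 r \o r23 r ->
  braided_set_type s D -> braided_set_type r (fun x y => D (q x) (q y)).
Proof.
move=> qr D0 rbr /braided_set_typeP sE; apply/braided_set_typeP => t.
pose q3 (u : X * X * X) := (q u.1.1, q u.1.2, q u.2).
have q12 u : r12 s (q3 u) = q3 (r12 r u).
  by case: u => [[x y] z]; rewrite /r12 /q3 /= qr.
have q23 u : r23 s (q3 u) = q3 (r23 r u).
  by case: u => [[x y] z]; rewrite /r23 /q3 /= qr.
rewrite rbr; congr (_ *: _).
have := malg_scaleU_inj _ (sE (q3 t)).
rewrite /weight121 /weight212 !(q12, q23) /= => wE.
by apply: wE; rewrite !mulf_neq0.
Qed.

Theorem proposition24 (R : realType) (A : leftBraceType) (I X : set A)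
    (r : X * X -> X * X)
    (d : retract_carrier X I -> retract_carrier X I -> R[i]) :
  ideal I ->
  set_solution r ->
  yb_restriction r ->
  (forall c e, d c e != 0) ->
  braided_set_type (retraction I r) d ->
  braided_set_type r
    (fun x y => d (retract_class I x) (retract_class I y)).
Proof.
move=> idI [_ _ rbr] rX d0; apply: braided_set_type_pullback => // x y.
exact: retractionE.
Qed.
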